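(* Let $T$ be the semigroup given by the semigroup presentation $$T = \langle a,b,c,d,e,x \mid axb = acx,\ ac = cd,\ xcd = xe,\ ed = ae,\ aex = ax,\ xexb = bxex \rangle.$$ For all $r,s,t\in T^1$, if $rst = s$ then $r=1$ and $t=1$. In particular, $T$ is $\mathcal{J}$-trivial.
   Context: For a semigroup $S$, $S^1$ denotes $S$ if $S$ has an identity and $S$ with an external identity adjoined otherwise; $1$ denotes the identity of $S^1$. Elements $x,y\in S$ are $\mathcal{J}$-related if $S^1xS^1 = S^1yS^1$. $S$ is $\mathcal{J}$-trivial if any two $\mathcal{J}$-related elements are equal. The presentation is a semigroup presentation: $T$ is the quotient of the free semigroup (nonempty words) on the generators by the congruence generated by the relations; the generator $e$ is not assumed to be idempotent or an identity. *)

(* Defs.v *)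
From HB Require Import structures.
From mathcomp Require Import all_boot.
From mathcomp Require Import boolp classical_sets.

Set Implicit Arguments.
Unset Strict Implicit.
Unset Printing Implicit Defensive.

Local Open Scope group_scope.
Local Open Scope quotient_scope.
Local Open Scope classical_set_scope.

Definition is_identity (S : semigroupType) (e : S) : Prop :=
  left_id e *%g /\ right_id e *%g.

Definition has_identity (S : semigroupType) : Prop :=
  exists e : S, is_identity e.

(* S^1: the new element None is present only when S has no identity. *)
Definition adjoin1 (S : semigroupType) : Type :=
  {u : option S | isSome u || ~~ `[< has_identity S >]}.

Section Adjoin1.
Variable S : semigroupType.

HB.instance Definition _ := Choice.on (adjoin1 S).

Definition to_adjoin1 (x : S) : adjoin1 S := exist _ (Some x) isT.

Definition omul (u v : option S) : option S :=
  match u, v with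
  | Some x, Some y => Some (x * y)
  | None, _ => v
  | _, None => u
  end.

Fact adjoin1_mul_subproof (u v : adjoin1 S) :
  isSome (omul (val u) (val v)) || ~~ `[< has_identity S >].
Proof. by case: u v => [[x|] p] [[y|] q]. Qed.

Definition adjoin1_mul (u v : adjoin1 S) : adjoin1 S :=
  exist _ (omul (val u) (val v)) (adjoin1_mul_subproof u v).

Definition oone : option S :=
  if pselect (has_identity S) is left h then Some (projT1 (cid h)) else None.

Fact adjoin1_one_subproof : isSome oone || ~~ `[< has_identity S >].
Proof. by rewrite /oone; case: pselect => // h; apply/asboolPn. Qed.

Definition adjoin1_one : adjoin1 S := exist _ oone adjoin1_one_subproof.

Fact adjoin1_mulA : associative adjoin1_mul.
Proof.
move=> u v w; apply: val_inj => /=.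
by case: (val u) (val v) (val w) => [x|] [y|] [z|] //=; rewrite mulgA.
Qed.

Fact adjoin1_mul1g : left_id adjoin1_one adjoin1_mul.
Proof.
move=> u; apply: val_inj; rewrite /= /oone.
case: pselect => //= h; case: (cid h) => e /= [e1 _].
case: u => [[x|] p] /=; first by rewrite e1.
by case/negP: p; apply/asboolP.
Qed.

Fact adjoin1_mulg1 : right_id adjoin1_one adjoin1_mul.
Proof.
move=> u; apply: val_inj; rewrite /= /oone.
case: pselect => [h|h] /=; last by case: (val u).
case: (cid h) => e /= [_ e1].
case: u => [[x|] p] /=; first by rewrite e1.
by case/negP: p; apply/asboolP.
Qed.

HB.instance Definition _ :=
  isMonoid.Build (adjoin1 S) adjoin1_mulA adjoin1_mul1g adjoin1_mulg1.

End Adjoin1.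

Definition principal_ideal (S : semigroupType) (x : S) : set (adjoin1 S) :=
  [set r * to_adjoin1 x * t | r in [set: adjoin1 S] & t in [set: adjoin1 S]].

Definition J_related (S : semigroupType) (x y : S) : Prop :=
  principal_ideal x = principal_ideal y.

Definition J_trivial (S : semigroupType) : Prop :=
  forall x y : S, J_related x y -> x = y.

Definition free_semigroup (A : choiceType) : Type :=
  {w : seq A | w != [::]}.

Section FreeSemigroup.
Variable A : choiceType.

HB.instance Definition _ := Choice.on (free_semigroup A).

Fact free_mul_subproof (u v : free_semigroup A) : val u ++ val v != [::].
Proof. by case: u => [[]]. Qed.

Definition free_mul (u v : free_semigroup A) : free_semigroup A :=
  exist _ (val u ++ val v) (free_mul_subproof u v).

Fact free_mulA : associative free_mul.
Proof. by move=> u v w; apply: val_inj; rewrite /= catA. Qed.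

HB.instance Definition _ := isSemigroup.Build (free_semigroup A) free_mulA.

Definition free_gen (g : A) : free_semigroup A := exist _ [:: g] isT.

End FreeSemigroup.

Inductive generated_congruence (S : semigroupType) (R : S -> S -> Prop) :
    S -> S -> Prop :=
  | gcong_base x y : R x y -> generated_congruence R x y
  | gcong_refl x : generated_congruence R x x
  | gcong_sym x y : generated_congruence R x y -> generated_congruence R y x
  | gcong_trans x y z : generated_congruence R x y ->
      generated_congruence R y z -> generated_congruence R x z
  | gcong_mul x x' y y' : generated_congruence R x x' ->
      generated_congruence R y y' -> generated_congruence R (x * y) (x' * y').

Section Presentation.
Variables (A : choiceType) (rels : seq (free_semigroup A * free_semigroup A)).

Definition pres_congruence : rel (free_semigroup A) :=
  fun u v => `[< generated_congruence (fun x y => (x, y) \in rels) u v >].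

Fact pres_congruence_refl : reflexive pres_congruence.
Proof. by move=> u; apply/asboolP; apply: gcong_refl. Qed.

Fact pres_congruence_sym : symmetric pres_congruence.
Proof. by move=> u v; apply: asbool_equiv_eq; split; apply: gcong_sym. Qed.

Fact pres_congruence_trans : transitive pres_congruence.
Proof.
by move=> v u w /asboolP uv /asboolP vw; apply/asboolP; apply: gcong_trans uv vw.
Qed.

Canonical pres_congruence_equiv := EquivRel pres_congruence
  pres_congruence_refl pres_congruence_sym pres_congruence_trans.

Definition presented_semigroup : Type := {eq_quot pres_congruence}.

HB.instance Definition _ := Choice.on presented_semigroup.
HB.instance Definition _ := EqQuotient.on presented_semigroup.

Definition pres_mul (x y : presented_semigroup) : presented_semigroup :=
  \pi_presented_semigroup (repr x * repr y).

Fact pi_pres_mul (u v : free_semigroup A) :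
  \pi_presented_semigroup (u * v) =
  pres_mul (\pi_presented_semigroup u) (\pi_presented_semigroup v).
Proof.
have repr_cong w : generated_congruence (fun x y => (x, y) \in rels)
    w (repr (\pi_presented_semigroup w)).
  by apply/asboolP; apply/(eqquotP presented_semigroup); rewrite reprK.
by apply/(eqquotP presented_semigroup)/asboolP; apply: gcong_mul.
Qed.

Fact pres_mulA : associative pres_mul.
Proof.
move=> x y z; rewrite -[x]reprK -[y]reprK -[z]reprK.
by rewrite -!pi_pres_mul mulgA !reprK.
Qed.

HB.instance Definition _ := isSemigroup.Build presented_semigroup pres_mulA.

End Presentation.

Inductive gen : Type := gen_a | gen_b | gen_c | gen_d | gen_e | gen_x.

Definition nat_of_gen (g : gen) : nat :=
  match g with
  | gen_a => 0 | gen_b => 1 | gen_c => 2 | gen_d => 3 | gen_e => 4 | gen_x => 5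
  end.

Definition gen_of_nat (n : nat) : gen :=
  nth gen_a [:: gen_a; gen_b; gen_c; gen_d; gen_e; gen_x] n.

Fact nat_of_genK : cancel nat_of_gen gen_of_nat.
Proof. by case. Qed.

HB.instance Definition _ := Countable.copy gen (can_type nat_of_genK).

Definition T_relations : seq (free_semigroup gen * free_semigroup gen) :=
  let a := free_gen gen_a in let b := free_gen gen_b in
  let c := free_gen gen_c in let d := free_gen gen_d in
  let e := free_gen gen_e in let x := free_gen gen_x in
  [:: (a * x * b, a * c * x);
      (a * c, c * d);
      (x * c * d, x * e);
      (e * d, a * e);
      (a * e * x, a * x);
      (x * e * x * b, b * x * e * x)].

Definition T : Type := presented_semigroup T_relations.

HB.instance Definition _ := Semigroup.on T.

(* Main.v *)
Require Import Defs.
From mathcomp Require Import all_boot.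
From mathcomp Require Import ssralg ssrint zify.
From mathcomp Require Import boolp.
Local Open Scope group_scope.

(** Two words congruent modulo the relations agree under every map of words
    that is multiplicative and identifies both sides of each relation. Suppose
    that the words rst and s represent the same element. The number of x's and
    the weight a, d -> 1; b, c -> -1; e, x -> 0 are invariant, so r and t are
    free of x and their weights cancel. The number of a's and d's before the
    first x is invariant, so r lies in {b,c,e}*. The weight a, c, d -> 1;
    e -> 2; b -> 0 of the part after the last x is invariant, so t lies in b*.
    Both weights are now nonpositive, hence zero, so t is empty and r = e^k.
    Finally T acts on pairs of naturals (see [nf_act]) so that e strictly
    increases the sum of the two entries, whence k = 0. *)

Notation T_cong := (generated_congruence (fun u v => (u, v) \in T_relations)).

Lemma T_cong_morph (M : Type) (op : M -> M -> M) (phi : seq gen -> M) :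
    {morph phi : u v / u ++ v >-> op u v} ->
    {in T_relations, forall p, phi (val p.1) = phi (val p.2)} ->
  forall u v, T_cong u v -> phi (val u) = phi (val v).
Proof.
move=> phiM phi_rel u v; elim=> {u v} //.
- by move=> u v /phi_rel.
- by move=> u v w _ -> _ ->.
- by move=> u u' v v' _ + _; rewrite /= !phiM => -> ->.
Qed.

(** Indexing the relations turns a check over all of them into six cases that compute on concrete
    words. *)
Lemma T_relationsP (P : free_semigroup gen * free_semigroup gen -> Prop) :
    (forall i, (i < 6)%N ->
      P (nth (free_gen gen_a, free_gen gen_a) T_relations i)) ->
  {in T_relations, forall p, P p}.
Proof.
by move=> P_nth p /(nthP (free_gen gen_a, free_gen gen_a))[i /P_nth + <-].
Qed.

Lemma T_cong_foldr (X : Type) (act : gen -> X -> X) :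
    {in T_relations, forall p z, foldr act z (val p.1) = foldr act z (val p.2)} ->
  forall u v, T_cong u v -> forall z, foldr act z (val u) = foldr act z (val v).
Proof.
move=> act_rel u v uv z.
pose phi w := foldr act ^~ w.
rewrite -/(phi (val u) z) -/(phi (val v) z).
congr (_ z); apply: (@T_cong_morph _ (fun f g => f \o g)) uv.
- by move=> w w'; apply/funext => y; rewrite /phi /= foldr_cat.
- by move=> p /act_rel p_rel; apply/funext.
Qed.

Lemma T_cong_foldl (X : Type) (act : X -> gen -> X) :
    {in T_relations, forall p z, foldl act z (val p.1) = foldl act z (val p.2)} ->
  forall u v, T_cong u v -> forall z, foldl act z (val u) = foldl act z (val v).
Proof.
move=> act_rel u v uv z.
pose phi w := foldl act ^~ w.
rewrite -/(phi (val u) z) -/(phi (val v) z).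
congr (_ z); apply: (@T_cong_morph _ (fun f g => g \o f)) uv.
- by move=> w w'; apply/funext => y; rewrite /phi /= foldl_cat.
- by move=> p /act_rel p_rel; apply/funext.
Qed.

Definition balance_act (g : gen) (z : int) : int :=
  match g with
  | gen_a | gen_d => (z + 1)%R
  | gen_b | gen_c => (z - 1)%R
  | gen_e | gen_x => z
  end.

Definition x_act (g : gen) (n : nat) : nat := if g is gen_x then n.+1 else n.

(** [foldr] reads a word from its last letter, so the reset at [gen_x] keeps only what precedes the
    first x. *)
Definition head_ad_act (g : gen) (n : nat) : nat :=
  match g with gen_x => 0 | gen_a | gen_d => n.+1 | _ => n end.

Definition tail_weight_act (n : nat) (g : gen) : nat :=
  match g with
  | gen_x => 0 | gen_a | gen_c | gen_d => n.+1 | gen_e => n.+2 | gen_b => n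
  end.

(* The words before the first x, modulo [ax = acx = aex] and [x = bx], have
   normal forms under cd -> ac, ed -> ae, acx -> ax, aex -> ax, bx -> x.
   The pair [(j, m)] records that such a normal form is d^j w with w not
   starting with d and of weight m, where a weighs 2, and c, d, e weigh 1; the
   letter b is ignored. Thus (0, 0) is the empty word, and [(0, 1)] is the word
   c or e, which a preceding a absorbs. *)
Definition nf_act (g : gen) (p : nat * nat) : nat * nat :=
  let: (j, m) := p in
  match g with
  | gen_a => if (j == 0) && (m == 1) then (0, 2) else (0, m + j + 2)
  | gen_b => p
  | gen_c | gen_e =>
      if (m == 0) && (0 < j) then (0, 2 * j) else (0, m + 2 * j + 1)
  | gen_d => (j.+1, m)
  | gen_x => (0, 0)
  end%N.

Lemma balance_act_rel : {in T_relations, forall p z,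
  foldr balance_act z (val p.1) = foldr balance_act z (val p.2)}.
Proof. by apply: T_relationsP; do 6?[case=> [_ z /=|]]; lia. Qed.

Lemma x_act_rel : {in T_relations, forall p n,
  foldr x_act n (val p.1) = foldr x_act n (val p.2)}.
Proof. by apply: T_relationsP; do 6?[case=> [//|]]. Qed.

Lemma head_ad_act_rel : {in T_relations, forall p n,
  foldr head_ad_act n (val p.1) = foldr head_ad_act n (val p.2)}.
Proof. by apply: T_relationsP; do 6?[case=> [//|]]. Qed.

Lemma tail_weight_act_rel : {in T_relations, forall p n,
  foldl tail_weight_act n (val p.1) = foldl tail_weight_act n (val p.2)}.
Proof. by apply: T_relationsP; do 6?[case=> [//|]]. Qed.

Lemma nf_act_rel : {in T_relations, forall p z,
  foldr nf_act z (val p.1) = foldr nf_act z (val p.2)}.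
Proof.
apply: T_relationsP; do 6?[case=> [_ [[|j] [|m]] //=|]] => //.
all: by do ?case: ifP => //=; move=> *; congr (_, _); lia.
Qed.

(** Plain words are compared so that the empty word can stand for 1; arbitrary starting values make
    the relation stable under concatenation. *)
Record invariant_eq (u v : seq gen) : Prop := InvariantEq {
  _ : forall z, foldr balance_act z u = foldr balance_act z v;
  _ : forall n, foldr x_act n u = foldr x_act n v;
  _ : forall n, foldr head_ad_act n u = foldr head_ad_act n v;
  _ : forall n, foldl tail_weight_act n u = foldl tail_weight_act n v;
  _ : forall p, foldr nf_act p u = foldr nf_act p v }.

Lemma T_cong_invariant_eq u v : T_cong u v -> invariant_eq (val u) (val v).
Proof.
move=> uv; split.
- exact: T_cong_foldr balance_act_rel _ _ uv.
- exact: T_cong_foldr x_act_rel _ _ uv.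
- exact: T_cong_foldr head_ad_act_rel _ _ uv.
- exact: T_cong_foldl tail_weight_act_rel _ _ uv.
- exact: T_cong_foldr nf_act_rel _ _ uv.
Qed.

Lemma invariant_eq_sym u v : invariant_eq u v -> invariant_eq v u.
Proof. by case=> h1 h2 h3 h4 h5; split=> z; rewrite ?h1 ?h2 ?h3 ?h4 ?h5. Qed.

Lemma invariant_eq_trans u v w :
  invariant_eq u v -> invariant_eq v w -> invariant_eq u w.
Proof.
by case=> h1 h2 h3 h4 h5 [k1 k2 k3 k4 k5];
   split=> z; rewrite ?h1 ?h2 ?h3 ?h4 ?h5.
Qed.

Lemma invariant_eq_catr u v w :
  invariant_eq u v -> invariant_eq (u ++ w) (v ++ w).
Proof.
by case=> h1 h2 h3 h4 h5;
   split=> z; rewrite ?foldr_cat ?foldl_cat ?h1 ?h2 ?h3 ?h4 ?h5.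
Qed.

Lemma foldr_x_act n w : foldr x_act n w = (count_mem gen_x w + n)%N.
Proof. by elim: w => // -[] w /= ->. Qed.

Lemma foldr_head_ad_act n w : gen_x \notin w ->
  foldr head_ad_act n w = (count_mem gen_a w + count_mem gen_d w + n)%N.
Proof.
by elim: w => // g w IHw; rewrite inE negb_or => /andP[+ /IHw];
  case: g => //= _ ->; lia.
Qed.

Lemma leq_foldr_head_ad_act n n' w :
  (n <= n')%N -> (foldr head_ad_act n w <= foldr head_ad_act n' w)%N.
Proof. by move=> le_n; elim: w => // -[]. Qed.

Lemma leq_foldl_tail_weight_act n n' w :
  (n <= n')%N -> (foldl tail_weight_act n w <= foldl tail_weight_act n' w)%N.
Proof. by elim: w n n' => // g w IHw n n' le_n /=; apply: IHw; case: g. Qed.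

Lemma foldl_tail_weight_act n w : gen_x \notin w ->
  foldl tail_weight_act n w =
  (n + count_mem gen_a w + count_mem gen_c w + count_mem gen_d w
   + 2 * count_mem gen_e w)%N.
Proof.
elim: w n => [|g w IHw] n; first by move=> _ /=; lia.
by rewrite inE negb_or => /andP[+ /IHw]; case: g => //= _ ->; lia.
Qed.

Lemma foldr_balance_act z w : foldr balance_act z w =
  (z + (count_mem gen_a w + count_mem gen_d w)%:Z
     - (count_mem gen_b w + count_mem gen_c w)%:Z)%R.
Proof. by elim: w => [|[] w /= ->] /=; lia. Qed.

Lemma size_count_gen w :
  size w = (count_mem gen_a w + count_mem gen_b w + count_mem gen_c w
            + count_mem gen_d w + count_mem gen_e w + count_mem gen_x w)%N.
Proof. by elim: w => // -[] w /= ->; lia. Qed.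

(** Each e raises j + m: to 2j if m = 0 < j, and to m + 2j + 1 otherwise. *)
Lemma leq_foldr_nf_act_nseq_e n p :
  (n + p.1 + p.2 <= (foldr nf_act p (nseq n gen_e)).1
                    + (foldr nf_act p (nseq n gen_e)).2)%N.
Proof.
elim: n => [|n IHn] /=; first by lia.
by case: (foldr _ _ _) IHn => j m /=; case: ifP => /= *; lia.
Qed.

Lemma invariant_eq_cat_nil r s t :
  invariant_eq (r ++ s ++ t) s -> r = [::] /\ t = [::].
Proof.
case=> bal xs head tail nf.
have := xs 0; rewrite !foldr_cat !foldr_x_act => x_eq.
have rx : gen_x \notin r by rewrite -has_pred1 has_count; lia.
have tx : gen_x \notin t by rewrite -has_pred1 has_count; lia.
have := head 0; rewrite !foldr_cat foldr_head_ad_act // => head_eq.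
(* Monotonicity in the starting value avoids a case split on whether s contains x. *)
have := leq_foldr_head_ad_act _ _ s (leq0n (foldr head_ad_act 0 t)).
move=> head_le.
have := tail 0; rewrite !foldl_cat foldl_tail_weight_act // => tail_eq.
have := leq_foldl_tail_weight_act _ _ s (leq0n (foldl tail_weight_act 0 r)).
move=> tail_le.
have := bal 0%R; rewrite !foldr_cat !foldr_balance_act => bal_eq.
have t0 : t = [::] by apply: size0nil; rewrite size_count_gen; lia.
have r_e : r = nseq (size r) gen_e.
  apply/all_pred1P; rewrite all_count [X in _ == X]size_count_gen; lia.
split=> //; apply: size0nil.
have := leq_foldr_nf_act_nseq_e (size r) (foldr nf_act (0, 0)%N s).
(* Empty words are turned back into t so that [nf] applies. *)
by rewrite -r_e -foldr_cat -[s in r ++ s]cats0 -{1 2}t0 nf; lia.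
Qed.

Definition word_of (u : adjoin1 T) : seq gen :=
  if val u is Some x then val (repr x) else [::].

(** Representatives are chosen, so the two words are only congruent, not equal. *)
Lemma word_ofM u v : invariant_eq (word_of (u * v)) (word_of u ++ word_of v).
Proof.
case: u v => [[x|] px] [[y|] py] //; rewrite /word_of /= ?cats0 //.
rewrite -[val (repr x) ++ _]/(val (repr x * repr y)).
apply: T_cong_invariant_eq; apply/asboolP.
by apply/(eqquotP (presented_semigroup T_relations)); rewrite reprK.
Qed.

Lemma word_of_cat_nil r s t :
  r * s * t = s -> word_of r = [::] /\ word_of t = [::].
Proof.
move=> rst; apply: (@invariant_eq_cat_nil _ (word_of s)).
rewrite -{2}rst catA; apply: invariant_eq_sym.
apply: invariant_eq_trans (word_ofM _ _) _.
exact: invariant_eq_catr (word_ofM _ _).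
Qed.

Lemma word_of_to_adjoin1 (x : T) : word_of (to_adjoin1 x) != [::].
Proof. exact: valP (repr x). Qed.

(** An identity i would satisfy i i 1 = i, forcing its nonempty representative to be empty. Hence
    the 1 of [adjoin1 T] is the adjoined element. *)
Lemma T_no_identity : ~ has_identity T.
Proof.
case=> i [i1 _]; have : to_adjoin1 i * to_adjoin1 i * 1 = to_adjoin1 i.
  by rewrite mulg1; apply: val_inj; rewrite /= i1.
by case/word_of_cat_nil => /eqP; rewrite (negPf (word_of_to_adjoin1 i)).
Qed.

Lemma word_of_eq_nil u : word_of u = [::] -> u = 1.
Proof.
case: u => [[x|] px] u0.
  by move/eqP: u0; rewrite (negPf (word_of_to_adjoin1 x)).
apply: val_inj; rewrite /= /oone; case: pselect => // h.
by case: T_no_identity.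
Qed.

Theorem lemma6 :
  (forall r s t : adjoin1 T, r * s * t = s -> r = 1 /\ t = 1) /\
  J_trivial T.
Proof.
have rst1 (r s t : adjoin1 T) : r * s * t = s -> r = 1 /\ t = 1.
  by case/word_of_cat_nil => /word_of_eq_nil-> /word_of_eq_nil->.
split=> // x y xy.
have self (z : T) : principal_ideal z (to_adjoin1 z).
  by exists 1 => //; exists 1 => //; rewrite mul1g mulg1.
have [r _ [t _ ryt]] : principal_ideal y (to_adjoin1 x) by rewrite -xy.
have [r' _ [t' _ r'xt']] : principal_ideal x (to_adjoin1 y) by rewrite xy.
(* Substituting one factorization into the other gives x = (r r') x (t' t). *)
have [rr' t't] : r * r' = 1 /\ t' * t = 1.
  by apply: (rst1 _ (to_adjoin1 x)); rewrite -[RHS]ryt -r'xt' !mulgA.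
(* Taking 1 as the middle factor shows that 1 has only trivial factors. *)
have [r1 _] : r = 1 /\ r' = 1 by apply: (rst1 _ 1); rewrite mulg1.
have [_ t1] : t' = 1 /\ t = 1 by apply: (rst1 _ 1); rewrite mulg1.
by move: ryt; rewrite r1 t1 mul1g mulg1 => /(congr1 val) [].
Qed.
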